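(* The axiom system $\mathsf{EKK}$ is sound for $\mathcal{L}_{E,K,\Box}$ with respect to the class of evidence interaction models: every theorem of $\mathsf{EKK}$ is true at every evidence scenario of every evidence interaction model.
   Context: $\mathcal{L}_{E,K,\Box}$ is generated by $\phi ::= p \mid \neg\phi \mid \phi\wedge\psi \mid E\phi \mid K\phi \mid \Box\phi$. An evidence interaction model is $\mathcal{M}=(X,\mathcal{E},\oplus,I,v)$ where $(\mathcal{E},\oplus)$ is a meet-semilattice, $X$ is a nonempty set, $I_e:X\to 2^X$ for $e\in\mathcal{E}$, $v:\textsc{prop}\to 2^X$, condition (E1) holds ($y\in I_e(x)$ implies $y\in I_e(y)$), and for all $x\in X$ and finite nonempty $\mathcal{E}'\subseteq\mathcal{E}$, $I_{\oplus\mathcal{E}'}(x)=\bigcap_{e\in\mathcal{E}'}I_e(x)$. Let $U_e=\{x : x\in I_e(x)\}$; an evidence scenario is $(x,e)$ with $x\in U_e$. Truth: $p$ via $v$; Booleans as usual; $(x,e)\models E\phi$ iff $I_e(x)\subseteq[\![\phi]\!]^e$; $(x,e)\models K\phi$ iff $U_e\subseteq[\![\phi]\!]^e$; $(x,e)\models\Box\phi$ iff there is $e'\in\mathcal{E}$ with $x\in U_{e\oplus e'}\subseteq[\![\phi]\!]^e$, where $[\![\phi]\!]^e=\{y\in U_e : (y,e)\models\phi\}$. $\mathsf{EKK}$ consists of: classical propositional logic with modus ponens; $\mathsf{S5}$ for $K$ (axioms K, T, 4, 5, necessitation); $\mathsf{KT}$ for $E$ (axioms K, T, necessitation); $K\phi\to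 E\phi$; $\mathsf{S4}$ for $\Box$ ($\Box(\phi\to\psi)\to(\Box\phi\to\Box\psi)$, $\Box\phi\to\phi$, $\Box\phi\to\Box\Box\phi$, necessitation for $\Box$); and $K\phi\to\Box\phi$. *)

(* Defs.v *)
(* Mathematical Components, with the sets of mathcomp-classical. *)
From mathcomp Require Import all_boot all_order finmap.
From mathcomp Require Import classical_sets.

Set Implicit Arguments.
Unset Strict Implicit.
Unset Printing Implicit Defensive.

Local Open Scope classical_set_scope.

Inductive form (prop : Type) : Type :=
| Atom of prop
| Neg of form prop
| And of form prop & form prop
| Ev of form prop
| Know of form prop
| Box of form prop.

(* Negation and conjunction are the only primitive connectives. *)
Definition Imp (prop : Type) (phi psi : form prop) : form prop :=
  Neg (And phi (Neg psi)).

(* Boolean evaluation in which every formula whose main connective is not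
   Boolean (an atom or a modal formula) counts as a propositional variable, so
   that [tautology] holds of exactly the substitution instances, in the full
   modal language, of classical propositional tautologies. *)
Fixpoint bool_eval (prop : Type) (V : form prop -> bool) (phi : form prop)
    : bool :=
  match phi with
  | Neg psi => ~~ bool_eval V psi
  | And psi chi => bool_eval V psi && bool_eval V chi
  | _ => V phi
  end.

Definition tautology (prop : Type) (phi : form prop) : Prop :=
  forall V : form prop -> bool, bool_eval V phi = true.

Inductive EKK (prop : Type) : form prop -> Prop :=
| EKK_taut phi : tautology phi -> EKK phi
| EKK_mp phi psi : EKK (Imp phi psi) -> EKK phi -> EKK psi
| EKK_K_K phi psi :
    EKK (Imp (Know (Imp phi psi)) (Imp (Know phi) (Know psi)))
| EKK_K_T phi : EKK (Imp (Know phi) phi)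
| EKK_K_4 phi : EKK (Imp (Know phi) (Know (Know phi)))
| EKK_K_5 phi : EKK (Imp (Neg (Know phi)) (Know (Neg (Know phi))))
| EKK_K_nec phi : EKK phi -> EKK (Know phi)
| EKK_E_K phi psi :
    EKK (Imp (Ev (Imp phi psi)) (Imp (Ev phi) (Ev psi)))
| EKK_E_T phi : EKK (Imp (Ev phi) phi)
| EKK_E_nec phi : EKK phi -> EKK (Ev phi)
| EKK_KE phi : EKK (Imp (Know phi) (Ev phi))
| EKK_Box_K phi psi :
    EKK (Imp (Box (Imp phi psi)) (Imp (Box phi) (Box psi)))
| EKK_Box_T phi : EKK (Imp (Box phi) phi)
| EKK_Box_4 phi : EKK (Imp (Box phi) (Box (Box phi)))
| EKK_Box_nec phi : EKK phi -> EKK (Box phi)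
| EKK_KBox phi : EKK (Imp (Know phi) (Box phi)).

(* The evidence combination is the meet of [evidence].  In [info_meet] the
   combination of a finite nonempty set A is the meet of its elements iterated
   from some e in A; by idempotence e may be any element of A, and its presence
   in A is what expresses that A is nonempty. *)
Record evidence_model (prop : Type) := EvidenceModel {
  world : Type;
  world_nonempty : [set: world] !=set0;
  evidence_disp : Order.disp_t;
  evidence : meetSemilatticeType evidence_disp;
  info : evidence -> world -> set world;
  info_E1 : forall e x y, info e x y -> info e y y;
  info_meet : forall (x : world) (A : {fset evidence}) (e : evidence),
    e \in A ->
    info (\big[Order.meet/e]_(a <- A) a) x = \bigcap_(a in [set` A]) info a x;
  valuation : prop -> set world
}.

Arguments valuation {prop} M _ _ : rename.

Definition domain (prop : Type) (M : evidence_model prop) (e : evidence M)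
    : set (world M) :=
  [set x | info e x x].

Definition scenario (prop : Type) (M : evidence_model prop) (x : world M)
    (e : evidence M) : Prop :=
  domain e x.

(* [sat phi e x] is defined for all pairs but is only meaningful when
   [scenario x e] holds; the truth sets [domain e `&` sat psi e] used in the
   modal clauses consult it only there. *)
Fixpoint sat (prop : Type) (M : evidence_model prop) (phi : form prop)
    (e : evidence M) (x : world M) {struct phi} : Prop :=
  match phi with
  | Atom p => valuation M p x
  | Neg psi => ~ sat psi e x
  | And psi chi => sat psi e x /\ sat chi e x
  | Ev psi => info e x `<=` domain e `&` sat psi e
  | Know psi => domain e `<=` domain e `&` sat psi e
  | Box psi => exists e' : evidence M,
      domain (Order.meet e e') x /\
      domain (Order.meet e e') `<=` domain e `&` sat psi e
  end.

(* Main.v *)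
(* Each axiom is checked pointwise. Box is evaluated with the evidence e held
   fixed, which gives 4 with the same witness e'; for the K axiom, witnesses e1
   and e2 are merged into their meet, because U_(e + e') is the intersection of
   U_e and U_e'. (E1) places I_e(x) inside U_e, hence K implies E. *)
Require Import Defs.
From mathcomp Require Import all_boot all_order classical_sets.
From mathcomp Require Import finmap boolp.

Set Implicit Arguments.
Unset Strict Implicit.
Unset Printing Implicit Defensive.

Import Order.Theory.

Local Open Scope classical_set_scope.

(** The start value [a] is met once more as an element of the set, and idempotence absorbs the
    repetition. The case [a = b] is separate because the enumeration then has one entry; otherwise
    it is a permutation of [[:: b; a]]. *)
Lemma big_meet_fset2 (d : Order.disp_t) (L : meetSemilatticeType d) (a b : L) :
  \big[Order.meet/a]_(c <- [fset a; b]%fset) c = Order.meet a b.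
Proof.
have [->|neq_ab] := eqVneq a b; first by rewrite fsetUid -fset_seq1 big_seq1_id.
have perm_ab : perm_eq [fset a; b]%fset [:: b; a].
  apply: uniq_perm => [||c]; rewrite ?fset_uniq //=.
    by rewrite inE eq_sym neq_ab.
  by rewrite !inE orbC.
by rewrite (perm_big _ perm_ab) /= !big_cons big_nil meetxx meetC.
Qed.

Section Semantics.
Variables (prop : Type) (M : evidence_model prop).
Implicit Types (phi psi : form prop) (e : evidence M) (x : world M).

(** Instance of [info_meet] for the set [[fset e; e']], with the meet iterated from [e]. *)
Lemma info_meet2 e e' x :
  info (Order.meet e e') x = info e x `&` info e' x.
Proof.
rewrite -big_meet_fset2 info_meet ?inE ?eqxx //.
apply/seteqP; split=> y.
  by move=> h; split; apply: h; rewrite /= !inE eqxx ?orbT.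
by move=> [ye ye'] a /=; rewrite !inE => /orP[] /eqP->.
Qed.

Lemma domain_meet e e' :
  domain (Order.meet e e') = domain e `&` domain e'.
Proof.
by apply/seteqP; split=> x; rewrite /domain /= info_meet2.
Qed.

Lemma sat_Imp phi psi e x :
  sat (Imp phi psi) e x <-> (sat phi e x -> sat psi e x).
Proof.
split=> [nand hphi|imp [hphi]]; last by apply; apply: imp.
by apply: contrapT => npsi; apply: nand.
Qed.

(** Truth at the fixed pair is itself a Boolean valuation: atoms and modal formulas agree by
    definition, so only the two connectives need checking. This makes tautologies true pointwise. *)
Lemma bool_evalE phi e x :
  bool_eval (fun psi => `[< sat psi e x >]) phi = `[< sat phi e x >].
Proof.
elim: phi => //= [phi ->|phi -> psi ->]; first by rewrite asbool_neg.
by rewrite asbool_and.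
Qed.

Lemma sat_tautology phi e x : tautology phi -> sat phi e x.
Proof. by move=> taut; apply/asboolP; rewrite -bool_evalE taut. Qed.

(** The witness is [e] itself, since its meet with itself is [e]. *)
Lemma sat_Box_of_domain phi e x :
  scenario x e -> domain e `<=` sat phi e -> sat (Box phi) e x.
Proof.
by move=> xe sub; exists e; rewrite meetxx; split=> // y ye; split; auto.
Qed.

End Semantics.

Theorem theorem6 (prop : Type) (phi : form prop) :
  EKK phi ->
  forall (M : evidence_model prop) (x : world M) (e : evidence M),
    scenario x e -> sat phi e x.
Proof.
(* The evidence [e] stays fixed while [x] is generalized: the necessitation rules need the induction
   hypothesis at other worlds of [domain e], but always with the same [e]. *)
move=> der M x e; elim: der x => {phi}.
- by move=> phi taut x _; apply: sat_tautology.
- move=> phi psi _ IHimp _ IHphi x xe.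
  by move/sat_Imp: (IHimp x xe); apply; apply: IHphi.
- move=> phi psi x xe; apply/sat_Imp => kimp; apply/sat_Imp => kphi y ye.
  split=> //; have [_ /sat_Imp] := kimp y ye; apply.
  by case: (kphi y ye).
- by move=> phi x xe; apply/sat_Imp => kphi; case: (kphi x xe).
(* The truth of [Know phi] depends on [e] only, so the assumption at [x] serves unchanged at [y];
   axiom 5 follows in the same way. *)
- by move=> phi x xe; apply/sat_Imp => kphi y ye.
- by move=> phi x xe; apply/sat_Imp => nkphi y ye.
- by move=> phi _ IH x xe y ye; split=> //; apply: IH.
- move=> phi psi x xe; apply/sat_Imp => eimp; apply/sat_Imp => ephi y ye.
  have [yU /sat_Imp imp] := eimp y ye; split=> //; apply: imp.
  by case: (ephi y ye).
- by move=> phi x xe; apply/sat_Imp => ephi; case: (ephi x xe).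
- by move=> phi _ IH x xe y /info_E1 ye; split=> //; apply: IH.
- by move=> phi x xe; apply/sat_Imp => kphi y /info_E1 ye; apply: kphi.
- move=> phi psi x xe; apply/sat_Imp => -[e1 [xe1 sub1]].
  apply/sat_Imp => -[e2 [xe2 sub2]].
  exists (Order.meet e1 e2); move: xe1 sub1 xe2 sub2.
  rewrite !domain_meet => -[_ xe1] sub1 [_ xe2] sub2.
  split=> // y [ye [ye1 ye2]]; split=> //.
  have [_ /sat_Imp] := sub1 y (conj ye ye1); apply.
  by case: (sub2 y (conj ye ye2)).
- by move=> phi x xe; apply/sat_Imp => -[e' [xe' sub]]; case: (sub x xe').
- move=> phi x xe; apply/sat_Imp => -[e' [xe' sub]].
  by exists e'; split=> // y ye'; split; [case: (sub y ye') | exists e'].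
- by move=> phi _ IH x xe; apply: sat_Box_of_domain.
- move=> phi x xe; apply/sat_Imp => kphi; apply: sat_Box_of_domain => // y ye.
  by case: (kphi y ye).
Qed.
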